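(* Let $\gamma>0$, $\varepsilon>0$, $p\in(0,1)$. Assume that $\Vert\mathbf{m}_{\mathscr{M}}(\mathbf{x})-\mathbf{m}_{\mathscr{M}}(\mathbf{x}')\Vert_2\geq\gamma$ holds for $\mu$-almost every $\mathbf{x},\mathbf{x}'\in\mathcal{X}$ such that $\Vert\mathbf{g}(\mathbf{x})-\mathbf{g}(\mathbf{x}')\Vert_2\geq\varepsilon$. Suppose that $$D=\sup_{\mathbf{x},\mathbf{x}'\in\mathcal{X}}\Vert\mathbf{g}(\mathbf{x})-\mathbf{g}(\mathbf{x}')\Vert_2<\infty$$ and that $\mathbf{x}_1,\mathbf{x}_1',\dots,\mathbf{x}_m,\mathbf{x}_m'\in\mathcal{X}$ are sampled independently according to the probability measure $\mu$ on $\mathcal{X}$. If the number of sampled pairs is at least $$m\geq\frac{D^4}{2\varepsilon^4}\left(\#(\mathscr{M})\ln2-\ln p\right)$$ and the greedy approximation of the problem $$\min_{\mathscr{S}\subseteq\mathscr{M}}\#(\mathscr{S})\quad\text{subject to}\quad f_{\gamma,\varepsilon,m}(\mathscr{S})=f_{\gamma,\varepsilon,m}(\mathscr{M})$$ produces a set $\mathscr{S}_K$, then $$F_\gamma(\mathscr{S}_K)<2\varepsilon^2$$ with probability at least $1-p$.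
   Context: $\mathcal{X}\subset\mathbb{R}^n$ carries a probability measure $\mu$; $\mathscr{M}$ is a finite set of sensors; the target $\mathbf{g}:\mathcal{X}\to\mathbb{R}^q$ and measurements $\mathbf{m}_j:\mathcal{X}\to\mathbb{R}^{d_j}$, $j\in\mathscr{M}$, are measurable. $\#(\cdot)$ denotes cardinality and $m$ is a positive integer. ''For $\mu$-almost every $\mathbf{x},\mathbf{x}'$'' means for $\mu\otimes\mu$-almost every pair $(\mathbf{x},\mathbf{x}')$. For $\mathscr{S}\subseteq\mathscr{M}$, $\mathbf{m}_{\mathscr{S}}=(\mathbf{m}_j)_{j\in\mathscr{S}}$ is the concatenated measurement and $$w_{\gamma,\mathbf{x},\mathbf{x}'}(\mathscr{S})=\min\left\{\tfrac{1}{\gamma^2}\Vert\mathbf{m}_{\mathscr{S}}(\mathbf{x})-\mathbf{m}_{\mathscr{S}}(\mathbf{x}')\Vert_2^2,\ 1\right\},$$ $$f_{\gamma,\varepsilon,m}(\mathscr{S})=\frac1m\sum_{\substack{1\leq i\leq m:\\ \Vert\mathbf{g}(\mathbf{x}_i)-\mathbf{g}(\mathbf{x}_i')\Vert_2\geq\varepsilon}}w_{\gamma,\mathbf{x}_i,\mathbf{x}_i'}(\mathscr{S})\Vert\mathbf{g}(\mathbf{x}_i)-\mathbf{g}(\mathbf{x}_i')\Vert_2^2,$$ $$F_\gamma(\mathscr{S})=\int_{\substack{(\mathbf{x},\mathbf{x}')\in\mathcal{X}\times\mathcal{X}:\\ \Vert\mathbf{m}_{\mathscr{S}}(\mathbf{x})-\mathbf{m}_{\mathscr{S}}(\mathbf{x}')\Vert_2<\gamma}}\Vert\mathbf{g}(\mathbf{x})-\mathbf{g}(\mathbf{x}')\Vert_2^2\,d\mu(\mathbf{x})\,d\mu(\mathbf{x}').$$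 The greedy approximation algorithm starts with $\mathscr{S}_0=\emptyset$, sets $\mathscr{S}_k=\mathscr{S}_{k-1}\cup\{j_k\}$ where $j_k$ maximizes $f_{\gamma,\varepsilon,m}(\mathscr{S}_{k-1}\cup\{j\})$ over $j\in\mathscr{M}\setminus\mathscr{S}_{k-1}$, and stops at the first $K$ with $f_{\gamma,\varepsilon,m}(\mathscr{S}_K)=f_{\gamma,\varepsilon,m}(\mathscr{M})$; its output $\mathscr{S}_K$ depends on the sample. *)

(* Defs.v *)
From HB Require Import structures.
From mathcomp Require Import all_boot all_order all_algebra.
From mathcomp Require Import all_classical all_reals all_analysis.

Set Implicit Arguments.
Unset Strict Implicit.
Unset Printing Implicit Defensive.

Import Order.TTheory GRing.Theory Num.Theory.
Import numFieldNormedType.Exports.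

Local Open Scope classical_set_scope.
Local Open Scope ring_scope.

(* A subset X of a measurable space with its trace sigma-algebra; X itself need
   not be measurable.  The point x0 only serves to meet the library's
   requirement that measurable types be pointed: a set that carries a
   probability measure is nonempty.  With n.-tuple R (product sigma-algebra)
   as ambient space, this is X with its Borel sigma-algebra. *)
Definition pointed_subset (T : choiceType) (X : set T) (x0 : X) : pointedType :=
  HB.pack (set_type X) (isPointed.Build (set_type X) x0).

Definition trace_space d (T : measurableType d) (X : set T) (x0 : X) :
    measurableType _ :=
  g_sigma_algebra_preimageType (set_val : pointed_subset x0 -> T).

Definition norm2 (R : realType) (I : finType) (v : I -> R) : R :=
  Num.sqrt (\sum_i v i ^+ 2).

Section sensors.
Context (R : realType) (M : finType) (d : M -> nat) (q : nat).
Context (dX : measure_display) (X : measurableType dX).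
Variables (g : X -> q.-tuple R) (ms : forall j : M, X -> (d j).-tuple R).

Definition target_dist (x x' : X) : R := norm2 (tnth (g x) \- tnth (g x')).

(* The concatenation (m_j)_{j in S}: its coordinates are indexed by the pairs
   of a sensor j in S and a coordinate of m_j. *)
Definition concat (S : {set M}) (x : X)
    (k : {k : {j : M & 'I_(d j)} | tag k \in S}) : R :=
  tnth (ms (tag (val k)) x) (tagged (val k)).

Definition sensor_dist (S : {set M}) (x x' : X) : R :=
  norm2 (concat (S := S) x \- concat (S := S) x').

Definition weight (gamma : R) (x x' : X) (S : {set M}) : R :=
  Num.min ((gamma ^+ 2)^-1 * sensor_dist S x x' ^+ 2) 1.

Definition empirical (gamma eps : R) (m : nat) (x x' : 'I_m -> X)
    (S : {set M}) : R :=
  m%:R^-1 * \sum_(i < m | eps <= target_dist (x i) (x' i))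
    weight gamma (x i) (x' i) S * target_dist (x i) (x' i) ^+ 2.

Definition ambiguity (mu : probability X R) (gamma : R) (S : {set M}) : \bar R :=
  (\int[mu \x mu]_(z in [set z | (sensor_dist S z.1 z.2 < gamma)%R])
     (target_dist z.1 z.2 ^+ 2)%R%:E)%E.

End sensors.

Section greedy.
Local Open Scope set_scope.
Context (R : realType) (M : finType).
Implicit Types (f : {set M} -> R) (S : {set M}).

Definition greedy_choice f S (j : M) : Prop :=
  j \notin S /\ forall i, i \notin S -> (f (i |: S) <= f (j |: S))%R.

(* Ties in the choice of j_k may be broken arbitrarily, hence a relation:
   SK is the output of some run S_0, ..., S_K of the greedy algorithm. *)
Definition greedy_output f SK : Prop :=
  exists (K : nat) (S_ : nat -> {set M}),
    [/\ S_ 0%N = finset.set0,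
        forall k, (k < K)%N ->
          exists2 j, greedy_choice f (S_ k) j & S_ k.+1 = j |: S_ k,
        forall k, (k < K)%N -> f (S_ k) <> f (finset.setTfor M),
        f (S_ K) = f (finset.setTfor M) & SK = S_ K].

Lemma greedy_output_exists f : exists S, greedy_output f S.
Proof.
pose step S := if [pick j | j \notin S] is Some j0
  then [arg max_(j > j0 | j \notin S) f (j |: S)]%O |: S else S.
have stepP S : S != finset.setTfor M ->
    exists2 j, greedy_choice f S j & step S = j |: S.
  rewrite /step; case: pickP => [j0 j0S _|S0 /negP[]]; last first.
    by apply/eqP/setP => j; rewrite inE; have /negbFE := S0 j.
  by case: arg_maxP => // j jS jmax; exists j.
pose S_ k := iter k step finset.set0.
have cS k : (k <= #|M|)%N -> #|S_ k| = k.
  elim: k => [|k IH] kM; first by rewrite cards0.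
  have Sk := IH (ltnW kM).
  have SkT : S_ k != finset.setTfor M.
    by apply: contraTneq kM => E; rewrite -Sk E cardsT ltnn.
  by have [j [jS _] E] := stepP _ SkT; rewrite /= E cardsU1 jS Sk.
have exK : exists k, f (S_ k) == f (finset.setTfor M).
  exists #|M|; apply/eqP; congr f.
  by apply/eqP; rewrite eqEcard finset.subsetT cardsT cS /=.
case: (ex_minnP exK) => K /eqP fK minK.
have lt k : (k < K)%N -> f (S_ k) <> f (finset.setTfor M).
  by move=> kK /eqP /minK; rewrite leqNgt kK.
exists (S_ K), K, S_; split=> // k /lt kK; apply: stepP.
by apply/eqP => E; apply: kK; rewrite E.
Qed.

End greedy.

Section sampling.
Context (R : realType) (dO : measure_display) (Omega : measurableType dO).
Variable (P : probability Omega R).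
Context (dX : measure_display) (X : measurableType dX) (I : finType).
Variable (z : I -> {RV P >-> X}).

Definition mutually_independent : Prop :=
  forall (J : {set I}) (A : I -> set X), (forall i, measurable (A i)) ->
    (P [set w | forall i, i \in J -> A i (z i w)]
       = \prod_(i in J) P (z i @^-1` A i))%E.

Definition iid_sample (mu : probability X R) : Prop :=
  mutually_independent /\
  forall i (A : set X), measurable A -> distribution P (z i) A = mu A.

End sampling.

(* Main.v *)
Require Import Defs.
From HB Require Import structures.
From mathcomp Require Import all_boot all_order all_algebra.
From mathcomp Require Import all_classical all_reals all_analysis.
From mathcomp Require Import measurable_realfun ring lra.

Set Implicit Arguments.
Unset Strict Implicit.
Unset Printing Implicit Defensive.

Import Order.TTheory GRing.Theory Num.Theory.
Import numFieldNormedType.Exports.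

Local Open Scope classical_set_scope.
Local Open Scope ring_scope.

(** The output S of the greedy algorithm satisfies f(S) = f(M).  Weights increase
    with the sensor set, so f(S) = f(M) forces the weights of S and M to agree on
    every sampled pair whose targets are at distance at least eps.  By separation
    the weight of M is almost surely 1 there, hence S itself separates these
    sampled pairs: almost surely no sample falls into the set A_S of pairs that
    are confused by S (sensor distance less than gamma) although their targets
    are at distance at least eps ([empirical_eq_separates]).

    Let a be the mass of A_S for the product measure.  Splitting the integral
    that defines F(S) along A_S gives F(S) <= D^2 a + eps^2 (1 - a)
    ([ambiguity_le]).  If F(S) >= 2 eps^2, this yields (D^2 - eps^2) a >= eps^2,
    so that a >= eps^2 / D^2 and, as a <= 1, also D^2 >= 2 eps^2.  The m sampled
    pairs are independent with the product law ([iid_pairs]), so all of them miss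
    A_S with probability (1 - a)^m <= exp(- m eps^2 / D^2).  Since
    D^2 >= 2 eps^2, we have D^4 / (2 eps^4) >= D^2 / eps^2, and the lower bound on
    m makes this at most p / 2^#(M) ([failure_bound]).

    A union bound over the at most 2^#(M) sets S with F(S) >= 2 eps^2 concludes.
    The good event is measurable because greedy runs depend on the sample only
    through the finitely many comparisons f(A) <= f(B)
    ([measurable_greedy_output]). *)

(** * Independent pairs from an independent sample *)

Section scaled_product_measure.
Local Open Scope ereal_scope.
Context d1 d2 (T1 : measurableType d1) (T2 : measurableType d2) (R : realType).

(** A multiple of mu1 x mu2 is itself the product measure (c mu1) x mu2, so
    uniqueness of product measures applies to it. *)
Lemma scaled_product_measure_unique (mu1 : probability T1 R)
    (mu2 : probability T2 R) (c : {nonneg R})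
    (rho : {measure set (T1 * T2) -> \bar R}) :
  (forall A B, measurable A -> measurable B ->
     rho (A `*` B) = c%:num%:E * (mu1 \x mu2) (A `*` B)) ->
  forall C, measurable C -> rho C = c%:num%:E * (mu1 \x mu2) C.
Proof.
move=> rhoE C mC.
have U := @product_measure_unique _ _ _ _ _ (mscale c mu1) mu2.
rewrite -(U rho)//; last first.
  by move=> A B mA mB; rewrite rhoE// product_measure1E// muleA.
apply: (U (mscale c (mu1 \x mu2))) => // A B mA mB.
by rewrite -[LHS]/(c%:num%:E * (mu1 \x mu2) (A `*` B)) product_measure1E// muleA.
Qed.
End scaled_product_measure.

Section iid.
Local Open Scope ereal_scope.
Context (R : realType) (dO : measure_display) (Omega : measurableType dO).
Context (P : probability Omega R) (dX : measure_display) (X : measurableType dX).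
Context (mu : probability X R) (m : nat) (x x' : 'I_m -> {RV P >-> X}).
Hypothesis sample : iid_sample (fun k : 'I_m + 'I_m =>
       match k with inl i => x i | inr i => x' i end) mu.

Lemma iid_rectangles (A A' : 'I_m -> set X) :
  (forall i, measurable (A i)) -> (forall i, measurable (A' i)) ->
  P [set w | forall i, (A i `*` A' i) (x i w, x' i w)] =
  \prod_i (mu \x mu) (A i `*` A' i).
Proof.
move=> mA mA'; have [indep ident] := sample.
pose AA (k : 'I_m + 'I_m) := match k with inl i => A i | inr i => A' i end.
have mAA k : measurable (AA k) by case: k => i /=; [exact: mA|exact: mA'].
transitivity (\prod_(k in finset.setTfor ('I_m + 'I_m)%type) mu (AA k)).
  transitivity (P [set w | forall k, k \in finset.setTfor ('I_m + 'I_m)%type ->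
      AA k ((match k with inl i => x i | inr i => x' i end : {RV P >-> X}) w)]).
    congr (P _); apply/seteqP; split => w /=.
      by move=> H [] i _ /=; have [] := H i.
    by move=> H i; split; [apply: (H (inl i))|apply: (H (inr i))];
      rewrite finset.in_setT.
  rewrite indep//; apply: eq_bigr => k _.
  by rewrite -(ident k).
rewrite (eq_bigl xpredT); last by move=> k; rewrite finset.in_setT.
rewrite big_sumType/= -big_split/=.
by apply: eq_bigr => i _; rewrite product_measure1E.
Qed.

Lemma measurable_pair_event (i : 'I_m) (B : set (X * X)) :
  measurable B -> measurable [set w | B (x i w, x' i w)].
Proof.
move=> mB; rewrite -[X in measurable X]setTI.
by apply: (measurable_fun_pair (f := x i) (g := x' i)).
Qed.

(** Independence of the coordinates only gives the law of the pairs on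
    rectangles.  The rectangles are traded for arbitrary measurable sets one index
    at a time: with the events of the other indices fixed, both sides are finite
    measures in the set B i that agree on rectangles. *)
Lemma iid_pairs (B : 'I_m -> set (X * X)) : (forall i, measurable (B i)) ->
  P [set w | forall i, B i (x i w, x' i w)] = \prod_i (mu \x mu) (B i).
Proof.
(* Only the first k of the sets B i are not assumed to be rectangles. *)
have rect k : forall B : 'I_m -> set (X * X), (forall i, measurable (B i)) ->
    (forall i : 'I_m, (k <= i)%N -> exists A A',
      [/\ measurable A, measurable A' & B i = A `*` A']) ->
    P [set w | forall i, B i (x i w, x' i w)] = \prod_i (mu \x mu) (B i).
  elim: k => [{}B mB Brect|k IH {}B mB Brect].
    have /choice[AA AAP] i : exists AA : set X * set X,
        [/\ measurable AA.1, measurable AA.2 & B i = AA.1 `*` AA.2].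
      by have [A [A' ?]] := Brect i isT; exists (A, A').
    have {}AAP i : [/\ measurable (AA i).1, measurable (AA i).2 &
      B i = (AA i).1 `*` (AA i).2] by exact: AAP.
    have -> : B = (fun i => (AA i).1 `*` (AA i).2).
      by apply/funext => i; have [] := AAP i.
    by apply: iid_rectangles => i; have [] := AAP i.
  have [mk|km] := leqP m k.
    by apply: IH => // i ki; have := leq_ltn_trans ki (ltn_ord i); rewrite ltnNge mk.
  pose i0 := Ordinal km.
  pose E := [set w | forall i, i != i0 -> B i (x i w, x' i w)].
  have mE : measurable E.
    have -> : E = \bigcap_(i in [set i | i != i0]) [set w | B i (x i w, x' i w)].
      by apply/seteqP; split.
    apply: fin_bigcap_measurable => [|i _]; last exact: measurable_pair_event.
    exact: finite_finset.
  pose c := \prod_(i | i != i0) (mu \x mu) (B i).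
  have upd C : measurable C -> (exists A A',
      [/\ measurable A, measurable A' & C = A `*` A']) ->
      P ([set w | C (x i0 w, x' i0 w)] `&` E) = c * (mu \x mu) C.
    move=> mC Crect.
    pose B' i := if i == i0 then C else B i.
    have -> : c * (mu \x mu) C = \prod_i (mu \x mu) (B' i).
      rewrite (bigD1 i0)//= [B' i0]/B' eqxx muleC; congr (_ * _).
      by apply: eq_bigr => i /negbTE ii0; rewrite /B' ii0.
    rewrite -IH.
    - congr (P _); apply/seteqP; split => w /=.
        by move=> [Cw Ew] i; rewrite /B'; case: eqP => [->//|/eqP/Ew].
      move=> H; split; first by have := H i0; rewrite /B' eqxx.
      by move=> i ii0; have := H i; rewrite /B' (negbTE ii0).
    - by move=> i; rewrite /B'; case: ifP.
    - move=> i ki; rewrite /B'; case: eqP => // /eqP ii0; apply: Brect.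
      by rewrite ltn_neqAle ki andbT eq_sym.
  (* The constant c is the mass of E: take the whole space, a rectangle. *)
  have cE : c = P E.
    have := upd setT; rewrite setTI probability_setT mule1 => -> //.
    by exists setT, setT; split=> //; rewrite setXTT.
  have zi0 : measurable_fun setT (fun w => (x i0 w, x' i0 w)).
    exact: measurable_fun_pair.
  (* The law of the pair of index i0 on the event E. *)
  have [rho rhoE] : exists rho : {measure set (X * X) -> \bar R},
      forall C, rho C = P ([set w | C (x i0 w, x' i0 w)] `&` E).
    by exists (measure_function_pushforward__canonical__measure_function_Measure
      (mrestr P mE) zi0).
  have cfin : c = (fine c)%:E by rewrite fineK// cE fin_num_measure.
  have c0 : (0 <= fine c)%R by rewrite cE fine_ge0.
  rewrite (bigD1 i0)//= -/c muleC.
  transitivity (rho (B i0)).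
    rewrite rhoE; congr (P _); apply/seteqP; split => w /=.
      by move=> H; split => // i _.
    by move=> [H0 H] i; have [->//|/H] := eqVneq i i0.
  rewrite cfin; apply: (scaled_product_measure_unique (c := NngNum c0)) => //.
  move=> A A' mA mA'; rewrite rhoE.
  rewrite upd//= -?cfin//; first exact: measurableX.
  by exists A, A'.
by move=> mB; apply: (rect m) => // i; rewrite leqNgt ltn_ord.
Qed.
End iid.

(** * Measurability of the greedy output *)

Section greedy.
Context (R : realType) (M : finType).

(** Greedy choices, the stopping test and f(S_K) = f(M) are all expressed by
    comparisons between values of f, equality being two comparisons. *)
Lemma greedy_output_order (f f' : {set M} -> R) S :
  (forall A B, (f A <= f B) = (f' A <= f' B)) ->
  greedy_output f S -> greedy_output f' S.
Proof.
move=> ff' [K [S_ [S0 step run stop ->]]].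
have eqf A B : f A = f B <-> f' A = f' B.
  by split=> /eqP; [rewrite eq_le !ff' -eq_le|rewrite eq_le -!ff' -eq_le] => /eqP.
exists K, S_; split=> //.
- move=> k kK; have [j [jS jmax] Sk] := step k kK.
  by exists j => //; split=> // i iS; rewrite -ff'; exact: jmax.
- by move=> k kK /eqf; exact: run.
- exact/eqf.
Qed.

(** The event is a finite union, over the comparison patterns that admit S as an
    output, of the events that the values F t have this pattern. *)
Lemma measurable_greedy_output d (T : measurableType d) (F : T -> {set M} -> R) S :
  (forall A, measurable_fun [set: T] (F^~ A)) ->
  measurable [set t | greedy_output (F t) S].
Proof.
move=> mF.
pose pat t := [ffun AB : {set M} * {set M} => F t AB.1 <= F t AB.2].
have -> : [set t | greedy_output (F t) S] =
    \bigcup_(c in [set c | exists2 t, pat t = c & greedy_output (F t) S])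
      \bigcap_(AB in [set: {set M} * {set M}])
        [set t | (F t AB.1 <= F t AB.2) = c AB].
  apply/seteqP; split => t /=.
    by move=> out; exists (pat t); [exists t|move=> AB _ /=; rewrite ffunE].
  move=> [c [t' <- out] tc]; apply: greedy_output_order out => A B.
  by have := tc (A, B) I; rewrite /= ffunE.
apply: fin_bigcup_measurable => [|c _]; first exact: finite_finset.
apply: fin_bigcap_measurable => [|AB _]; first exact: finite_finset.
rewrite -[X in measurable X]setTI.
have mle := measurable_fun_ler (mF AB.1) (mF AB.2).
exact: (mle measurableT [set c AB]).
Qed.
End greedy.

(** * Distances, weights and confused pairs *)

Section sensors.
Context (R : realType).

Lemma norm2_ge0 (I : finType) (v : I -> R) : 0 <= norm2 v.
Proof. exact: sqrtr_ge0. Qed.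

Lemma measurable_norm2 d (T : measurableType d) (I : finType) (f : T -> I -> R) :
  (forall i, measurable_fun [set: T] (f^~ i)) ->
  measurable_fun [set: T] (fun t => norm2 (f t)).
Proof.
move=> mf; apply: (measurableT_comp (f := @Num.sqrt R)).
  by apply: continuous_measurable_fun; exact: sqrt_continuous.
by apply: measurable_sum => i; exact: measurable_funX.
Qed.

Context (M : finType) (d : M -> nat) (q : nat).
Context (dX : measure_display) (X : measurableType dX).
Context (g : X -> q.-tuple R) (ms : forall j : M, X -> (d j).-tuple R).

Lemma sensor_dist_subset (S S' : {set M}) x x' : S \subset S' ->
  sensor_dist ms S x x' <= sensor_dist ms S' x x'.
Proof.
move=> /fintype.subsetP SS'.
have sumE A : \sum_k (concat ms (S := A) x \- concat ms (S := A) x') k ^+ 2 =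
    \sum_(k : {j : M & 'I_(d j)} | tag k \in A)
      (tnth (ms (tag k) x) (tagged k) - tnth (ms (tag k) x') (tagged k)) ^+ 2.
  by rewrite (big_sub (fun k : {j : M & 'I_(d j)} => tag k \in A)).
rewrite /sensor_dist /norm2 ler_sqrt; last first.
  by apply: sumr_ge0 => k _; exact: sqr_ge0.
rewrite !sumE [leLHS]big_mkcond [leRHS]big_mkcond/=; apply: ler_sum => k _.
by case: ifPn => [/SS' ->//|_]; case: ifP => // _; exact: sqr_ge0.
Qed.

Lemma weight_subset gamma x x' (S S' : {set M}) : S \subset S' ->
  weight ms gamma x x' S <= weight ms gamma x x' S'.
Proof.
move=> SS'; rewrite /weight le_min2// ler_wpM2l ?invr_ge0 ?sqr_ge0//.
by rewrite ler_sqr ?nnegrE ?norm2_ge0// sensor_dist_subset.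
Qed.

Lemma weight_eq1 gamma x x' (S : {set M}) : 0 < gamma ->
  (weight ms gamma x x' S == 1) = (gamma <= sensor_dist ms S x x').
Proof.
move=> gamma0; rewrite /weight eq_minr mulrC ler_pdivlMr ?exprn_gt0// mul1r.
by rewrite ler_sqr ?nnegrE ?norm2_ge0// ltW.
Qed.

(** The two sums agree and are comparable term by term, so they agree term by
    term; a weight of S equal to a weight of M that is 1 is 1 itself. *)
Lemma empirical_eq_separates gamma eps m (x x' : 'I_m -> X) (S : {set M}) :
  0 < gamma -> 0 < eps ->
  empirical g ms gamma eps x x' S = empirical g ms gamma eps x x' (finset.setTfor M) ->
  forall i, eps <= target_dist g (x i) (x' i) ->
    gamma <= sensor_dist ms (finset.setTfor M) (x i) (x' i) ->
    gamma <= sensor_dist ms S (x i) (x' i).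
Proof.
move=> gamma0 eps0 + i epsi sepi.
have m0 : m%:R != 0 :> R.
  by rewrite pnatr_eq0 -lt0n (leq_ltn_trans _ (ltn_ord i)).
move=> /(mulfI (invr_neq0 m0)) /esym/eqP; rewrite -subr_eq0 -sumrB => /eqP.
move=> /psumr_eq0P/= /(_ _ i epsi) => eq0.
have {eq0}/eqP : weight ms gamma (x i) (x' i) (finset.setTfor M) *
    target_dist g (x i) (x' i) ^+ 2 -
    weight ms gamma (x i) (x' i) S * target_dist g (x i) (x' i) ^+ 2 = 0.
  apply: eq0 => j _; rewrite -mulrBl mulr_ge0 ?sqr_ge0// subr_ge0.
  by rewrite weight_subset// finset.subsetT.
rewrite -mulrBl mulf_eq0 expf_eq0/= (gt_eqF (lt_le_trans eps0 epsi)) orbF subr_eq0.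
move=> wE; rewrite -weight_eq1// -(eqP wE).
by rewrite weight_eq1.
Qed.

Definition confused gamma eps (S : {set M}) : set (X * X) :=
  [set z | sensor_dist ms S z.1 z.2 < gamma /\ eps <= target_dist g z.1 z.2].

Hypothesis (g_meas : measurable_fun [set: X] g).
Hypothesis (ms_meas : forall j : M, measurable_fun [set: X] (ms j)).

Lemma measurable_target_dist :
  measurable_fun [set: X * X] (fun z => target_dist g z.1 z.2).
Proof.
have gi i := (measurable_fun_tnthP g).1 g_meas i.
apply: measurable_norm2 => i; apply: measurable_funB.
  exact: (measurableT_comp (gi i) measurable_fst).
exact: (measurableT_comp (gi i) measurable_snd).
Qed.

Lemma measurable_sensor_dist (S : {set M}) :
  measurable_fun [set: X * X] (fun z => sensor_dist ms S z.1 z.2).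
Proof.
have mi j i := (measurable_fun_tnthP (ms j)).1 (@ms_meas j) i.
apply: measurable_norm2 => k; apply: measurable_funB.
  exact: (measurableT_comp (mi _ _) measurable_fst).
exact: (measurableT_comp (mi _ _) measurable_snd).
Qed.

Lemma measurable_confused gamma eps S : measurable (confused gamma eps S).
Proof.
apply: measurableI; rewrite -[X in measurable X]setTI.
  have mlt := measurable_fun_ltr (measurable_sensor_dist S) (measurable_cst gamma).
  exact: (mlt measurableT [set true]).
have mle := measurable_fun_ler (measurable_cst eps) measurable_target_dist.
exact: (mle measurableT [set true]).
Qed.

End sensors.

(** * The failure probability of one sensor set *)

Section bounds.
Context (R : realType).

(** In terms of u = D^2 / eps^2, the bound on the ambiguity reads
    (u - 1) a >= 1.  As a <= 1 this forces u >= 2, and then a u^2 / 2 >= 1, where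
    u^2 / 2 is the factor in the lower bound on m; finally 1 - a <= exp (- a). *)
Lemma failure_bound (a eps D p : R) (k m : nat) : 0 < eps -> 0 < p -> p < 1 ->
  0 <= a -> a <= 1 -> 2 * eps ^+ 2 <= D ^+ 2 * a + eps ^+ 2 * (1 - a) ->
  D ^+ 4 / (2 * eps ^+ 4) * (k%:R * ln 2 - ln p) <= m%:R ->
  (1 - a) ^+ m <= p / 2 ^+ k.
Proof.
move=> eps0 p0 p1 a_ge0 a1 amb m_large.
have e2 : 0 < eps ^+ 2 by rewrite exprn_gt0.
pose u := D ^+ 2 / eps ^+ 2.
have DE : D ^+ 2 = u * eps ^+ 2 by rewrite divfK// gt_eqF.
have {amb}amb : 1 <= (u - 1) * a.
  rewrite -(ler_pM2r e2); move: amb; rewrite DE; lra.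
have a0 : 0 < a.
  rewrite lt_neqAle a_ge0 andbT; apply/eqP => a0.
  by move: amb; rewrite -a0 mulr0 ler10.
have u1 : 0 < u - 1 by rewrite -(pmulr_lgt0 _ a0) (lt_le_trans ltr01).
have u2 : 2 <= u by nra.
set L := k%:R * ln 2 - ln p in m_large.
have L0 : 0 <= L.
  rewrite subr_ge0 (@le_trans _ _ 0)//; first by rewrite ln_le0// ltW.
  by rewrite mulr_ge0// ln_ge0// ler1n.
have {m_large}m_large : u ^+ 2 / 2 * L <= m%:R.
  apply: le_trans m_large; rewrite ler_wpM2r// /u le_eqVlt; apply/orP; left.
  apply/eqP; field; by rewrite gt_eqF.
have Lam : L <= a * m%:R.
  have : 1 <= a * (u ^+ 2 / 2).
    have : 0 <= a * u * (u - 2) by rewrite mulr_ge0 ?subr_ge0// mulr_ge0// (le_trans _ u2).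
    nra.
  move=> h; apply: le_trans (_ : a * (u ^+ 2 / 2 * L) <= _); last by rewrite ler_pM2l.
  by rewrite mulrA ler_peMl.
have -> : p / 2 ^+ k = expR (- L).
  rewrite opprB expRD lnK ?posrE// expRN expRM_natl.
  by rewrite lnK ?posrE.
apply: (@le_trans _ _ (expR (- a) ^+ m)).
  by rewrite lerXn2r ?nnegrE ?expR_ge0 ?subr_ge0// expR_ge1Dx.
by rewrite -expRM_natl ler_expR mulr_natl mulNrn lerN2 -mulr_natr.
Qed.
End bounds.

Section ambiguity.
Context (R : realType) (M : finType) (d : M -> nat) (q : nat).
Context (dX : measure_display) (X : measurableType dX).
Context (g : X -> q.-tuple R) (ms : forall j : M, X -> (d j).-tuple R).
Hypothesis (g_meas : measurable_fun [set: X] g).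
Hypothesis (ms_meas : forall j : M, measurable_fun [set: X] (ms j)).
Context (mu : probability X R).

(** On confused pairs the target distance is at most D; the other pairs in the
    domain of integration have target distance less than eps. *)
Lemma ambiguity_le gamma eps D a (S : {set M}) :
  (forall z, target_dist g z.1 z.2 <= D) ->
  (mu \x mu)%E (confused g ms gamma eps S) = a%:E ->
  (ambiguity g ms mu gamma S <= (D ^+ 2 * a + eps ^+ 2 * (1 - a))%:E)%E.
Proof.
set A := confused _ _ _ _ _ => gD aE.
have mA : measurable A by exact: measurable_confused.
pose C := [set z : X * X | sensor_dist ms S z.1 z.2 < gamma].
have mC : measurable C.
  have mlt := measurable_fun_ltr (measurable_sensor_dist ms_meas S) (measurable_cst gamma).
  by rewrite -[C]setTI; exact: (mlt measurableT [set true]).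
have mh B : measurable_fun B (fun z : X * X => (target_dist g z.1 z.2 ^+ 2)%:E).
  apply: (measurable_funS measurableT) => //; apply/measurable_EFinP.
  by apply: measurable_funX; exact: measurable_target_dist.
have le_on B r : measurable B -> (forall z, B z -> target_dist g z.1 z.2 <= r) ->
    (\int[mu \x mu]_(z in B) (target_dist g z.1 z.2 ^+ 2)%:E <= (r ^+ 2)%:E * (mu \x mu) B)%E.
  move=> mB Br; rewrite -integral_cst//; apply: ge0_le_integral => //.
  - by move=> z _; rewrite lee_fin sqr_ge0.
  - move=> z Bz; rewrite lee_fin ler_sqr ?nnegrE ?norm2_ge0 ?Br//.
    exact: le_trans (norm2_ge0 _) (Br z Bz).
have AC : A `<=` C by move=> z [].
rewrite /ambiguity -/C -(setDUK AC) ge0_integral_setU//; last 3 first.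
- exact: measurableD.
- by move=> z _; rewrite lee_fin sqr_ge0.
- by rewrite disj_set2E setDIK.
rewrite EFinD; apply: leeD.
  by rewrite EFinM -aE; exact: le_on.
apply: le_trans (le_on _ eps _ _) _.
- exact: measurableD.
- by move=> z [Cz nAz]; rewrite leNgt; apply/negP => /ltW epsz; apply: nAz.
rewrite [leRHS]EFinM; apply: lee_wpmul2l; first by rewrite lee_fin sqr_ge0.
rewrite EFinB -aE -probability_setC//; apply: le_measure; rewrite ?inE//.
  exact: measurableD.
exact: measurableC.
Qed.

End ambiguity.

Section sampling.
Context (R : realType) (M : finType) (d : M -> nat) (q : nat).
Context (dX : measure_display) (X : measurableType dX).
Context (g : X -> q.-tuple R) (ms : forall j : M, X -> (d j).-tuple R).
Hypothesis (g_meas : measurable_fun [set: X] g).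
Hypothesis (ms_meas : forall j : M, measurable_fun [set: X] (ms j)).
Context (mu : probability X R).
Context (m : nat) (dO : measure_display) (Omega : measurableType dO)
    (P : probability Omega R) (x x' : 'I_m -> {RV P >-> X}).
Hypothesis (sample : iid_sample (fun k : 'I_m + 'I_m =>
       match k with inl i => x i | inr i => x' i end) mu).

Lemma measurable_empirical gamma eps (S : {set M}) :
  measurable_fun [set: Omega] (fun w => empirical g ms gamma eps (x^~ w) (x'^~ w) S).
Proof.
have pair i : measurable_fun [set: Omega] (fun w => (x i w, x' i w)).
  exact: measurable_fun_pair.
have mt i := measurableT_comp (measurable_target_dist g_meas) (pair i).
have msd i := measurableT_comp (measurable_sensor_dist ms_meas S) (pair i).
apply: measurable_funM => //.
under eq_fun do rewrite big_mkcond.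
apply: measurable_sum => i.
apply: measurable_fun_ifT => //.
  exact: (measurable_fun_ler (measurable_cst eps) (mt i)).
apply: measurable_funM; last exact: measurable_funX (mt i).
apply: measurable_minr => //.
by apply: measurable_funM => //; exact: measurable_funX (msd i).
Qed.

(** Outputting S means that every sampled pair is either not confused by S or in
    the null set where M fails to separate. *)
Lemma greedy_failure_le gamma eps D p S : 0 < gamma -> 0 < eps -> 0 < p -> p < 1 ->
  {ae (mu \x mu)%E, forall z,
       eps <= target_dist g z.1 z.2 -> gamma <= sensor_dist ms (finset.setTfor M) z.1 z.2} ->
  (forall z, target_dist g z.1 z.2 <= D) ->
  D ^+ 4 / (2 * eps ^+ 4) * (#|M|%:R * ln 2 - ln p) <= m%:R ->
  ((2 * eps ^+ 2)%:E <= ambiguity g ms mu gamma S)%E ->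
  (P [set w | greedy_output (empirical g ms gamma eps (x^~ w) (x'^~ w)) S] <=
    (p / 2 ^+ #|M|)%:E)%E.
Proof.
move=> gamma0 eps0 p0 p1 [N [mN N0 sepN]] gD m_large amb.
pose A := confused g ms gamma eps S.
have mA : measurable A by exact: measurable_confused.
pose a := fine ((mu \x mu)%E A).
have nufin C : measurable C -> (mu \x mu)%E C \is a fin_num
  by exact: (fin_num_measure ((mu \x mu)%E : probability (X * X)%type R)).
have aE : (mu \x mu)%E A = a%:E by rewrite fineK// nufin.
have a0 : 0 <= a by rewrite -lee_fin -aE.
have a1 : a <= 1 by rewrite -lee_fin -aE probability_le1.
pose B := ~` A `|` N.
have mB : measurable B by apply: measurableU => //; exact: measurableC.
have nuB : ((mu \x mu) B <= (1 - a)%:E)%E.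
  rewrite EFinB -aE -probability_setC// -[leRHS]adde0 -N0.
  by apply: measureU2 => //; exact: measurableC.
apply: (@le_trans _ _ (P [set w | forall i, B (x i w, x' i w)])).
  apply: le_measure; rewrite ?inE.
  - by apply: measurable_greedy_output => T; exact: measurable_empirical.
  - have -> : [set w | forall i, B (x i w, x' i w)] =
      \bigcap_(i in [set: 'I_m]) [set w | B (x i w, x' i w)].
      by apply/seteqP; split=> w /= H i; [move=> _; exact: H|exact: H].
    apply: fin_bigcap_measurable => [|i _]; first exact: finite_finset.
    exact: measurable_pair_event.
  move=> w /= [K [S_ [_ _ _ fK SK]]] i.
  have [Nz|nNz] := pselect (N (x i w, x' i w)); [by right|left].
  move=> [/= sS epsi]; move: sS; apply/negP; rewrite -leNgt.
  rewrite SK; apply: (empirical_eq_separates gamma0 eps0 fK epsi).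
  apply: contrapT => nsep; apply: nNz; apply: sepN => /= H.
  exact/nsep/H.
rewrite (iid_pairs sample (B := fun=> B))//.
have -> : (\prod_(i < m) (mu \x mu) B = (fine ((mu \x mu) B) ^+ m)%:E)%E.
  under eq_bigr do rewrite -[(mu \x mu)%E B]fineK ?nufin//.
  by rewrite prodEFin prodr_const card_ord.
rewrite lee_fin; apply: (@le_trans _ _ ((1 - a) ^+ m)).
  rewrite lerXn2r ?nnegrE ?subr_ge0 ?fine_ge0//.
  by rewrite -lee_fin fineK// nufin.
apply: (failure_bound eps0 p0 p1 a0 a1 _ m_large).
by rewrite -lee_fin (le_trans amb)// ambiguity_le.
Qed.
End sampling.

(** * Union bound *)

Lemma probability_bigcup_le (R : realType) d (T : measurableType d)
    (P : probability T R) (I : finType) (E : I -> set T) (c : R) :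
  (forall i, measurable (E i)) -> (forall i, (P (E i) <= c%:E)%E) ->
  (P (\bigcup_i E i) <= (#|I|%:R * c)%:E)%E.
Proof.
move=> mE Ec.
have union_le (s : seq I) :
    (P (\big[setU/set0]_(i <- s) E i) <= ((size s)%:R * c)%:E)%E.
  elim: s => [|i s IH]; first by rewrite big_nil measure0 mul0r.
  rewrite big_cons/= -[in leRHS]natr1 mulrDl mul1r addrC EFinD.
  apply: le_trans (measureU2 _ (mE i) _) (leeD (Ec i) IH).
  exact: bigsetU_measurable.
rewrite cardE (le_trans _ (union_le (enum I)))// -bigcup_seq.
rewrite (_ : [set` enum I] = setT)//.
by apply/seteqP; split=> // i _; rewrite /= mem_enum.
Qed.

Theorem theorem5p3 (R : realType) (n q : nat) (M : finType) (d : M -> nat)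
    (X : set (n.-tuple R)) (x0 : X) (mu : probability (trace_space x0) R)
    (g : trace_space x0 -> q.-tuple R)
    (ms : forall j : M, trace_space x0 -> (d j).-tuple R)
    (g_meas : measurable_fun [set: trace_space x0] g)
    (ms_meas : forall j : M, measurable_fun [set: trace_space x0] (ms j))
    (gamma eps p : R) (gamma_gt0 : 0 < gamma) (eps_gt0 : 0 < eps)
    (p_gt0 : 0 < p) (p_lt1 : p < 1)
    (separated : {ae (mu \x mu)%E, forall z,
       eps <= target_dist g z.1 z.2 -> gamma <= sensor_dist ms (finset.setTfor M) z.1 z.2})
    (D : R)
    (D_sup : ereal_sup
       [set (target_dist g z.1 z.2)%:E | z in [set: trace_space x0 * trace_space x0]]
       = D%:E)
    (m : nat) (m_gt0 : (0 < m)%N)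
    (dO : measure_display) (Omega : measurableType dO)
    (P : probability Omega R)
    (x x' : 'I_m -> {RV P >-> trace_space x0})
    (sample : iid_sample (fun k : 'I_m + 'I_m =>
       match k with inl i => x i | inr i => x' i end) mu)
    (m_large : D ^+ 4 / (2 * eps ^+ 4) * (#|M|%:R * ln 2 - ln p) <= m%:R) :
  let good := [set w : Omega | forall SK : {set M},
    greedy_output (empirical g ms gamma eps (x^~ w) (x'^~ w)) SK ->
    (ambiguity g ms mu gamma SK < (2 * eps ^+ 2)%:E)%E] in
  measurable good /\ ((1 - p)%:E <= P good)%E.
Proof.
have gD z : target_dist g z.1 z.2 <= D.
  by rewrite -lee_fin -D_sup; apply: ereal_sup_ubound; exists z.
(* The ambiguity condition is not random: bad S is empty or a greedy event. *)
pose bad S := [set w | (2 * eps ^+ 2)%:E <= ambiguity g ms mu gamma S /\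
  greedy_output (empirical g ms gamma eps (x^~ w) (x'^~ w)) S]%E.
have badE S : bad S = if ((2 * eps ^+ 2)%:E <= ambiguity g ms mu gamma S)%E then
    [set w | greedy_output (empirical g ms gamma eps (x^~ w) (x'^~ w)) S] else set0.
  by apply/seteqP; split => w; rewrite /bad; case: ifP => [amb|/negP namb] //= [].
have mbad S : measurable (bad S).
  rewrite badE; case: ifP => // _; apply: measurable_greedy_output => T.
  exact: measurable_empirical.
have bad_le S : (P (bad S) <= (p / 2 ^+ #|M|)%:E)%E.
  rewrite badE; case: ifP => [amb|_].
    exact: (greedy_failure_le g_meas ms_meas sample gamma_gt0 eps_gt0 p_gt0 p_lt1
      separated gD m_large amb).
  by rewrite measure0 lee_fin divr_ge0 ?exprn_ge0// ltW.
move=> good.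
have -> : good = ~` \bigcup_S bad S.
  apply/seteqP; split => w /=.
    by move=> gw [S _ [amb /gw]]; rewrite ltNge amb.
  by move=> nbad S out; rewrite ltNge; apply/negP => amb; apply: nbad; exists S.
have mbads : measurable (\bigcup_S bad S).
  by apply: fin_bigcup_measurable => // ; exact: finite_finset.
split; first exact: measurableC.
rewrite probability_setC// EFinB leeB//.
have := probability_bigcup_le mbad bad_le.
rewrite -cardsT -finset.powersetT card_powerset cardsT natrX.
by rewrite mulrCA divff ?mulr1// expf_neq0.
Qed.
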